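(* Let $\Omega$ be a compact region of an algebraic manifold $\mathbb{M}\subset\mathbb{R}^d$ which satisfies a cone condition. Then the $\ell_1$-minimizing approximator $\mathcal{T}_X$ defined in the context (with polynomial degree $k$) has the following property: for every $k\in\mathbb{N}$ there exist constants $\Gamma>0$ and $C_T$ so that for every $\epsilon>0$ and any finite $X=\{x_1,\dots,x_N\}\subset\Omega$ with $h_X\le\Gamma\epsilon$, $\mathcal{T}_X$ is an operator $\mathcal{T}_X:\mathbb{R}^N\to C(\Omega)$ which satisfies (1) stability: $\|\mathcal{T}_X\vec c\|_{C(\Omega)}\le(1+\epsilon)\|\vec c\|_{\ell_\infty(X)}$ for $\vec c\in\mathbb{R}^N$; (2) approximation: $\|(\mathcal{T}_X\circ S_X)f-f\|_{C(\Omega)}\le C_T\Bigl(\dfrac{h_X}{\epsilon}\Bigr)^{k+1}\|f\|_{C^{k+1}(\Omega)}$ for $f\in C^{k+1}(\Omega)$, where $S_X:C(\Omega)\to\mathbb{R}^N$ is the sampling operator $S_Xf=f|_X$.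
   Context: An algebraic manifold is a smooth compact embedded submanifold $\mathbb{M}\subset\mathbb{R}^d$ without boundary, of dimension $d_{\mathbb{M}}$, contained in a real algebraic subset of $\mathbb{R}^d$ of the same dimension; it carries the Riemannian metric inherited from $\mathbb{R}^d$. Distances $\mathrm{dist}$ and balls $B(z,r)$ are with respect to the Riemannian distance of $\mathbb{M}$. $\Omega\subset\mathbb{M}$ satisfies a cone condition if there are $R>0$ and $\theta\in(0,\pi/2)$ such that for every $z\in\Omega$ there is a unit vector $w\in T_z\mathbb{M}$ with $\exp_z(tu)\in\Omega$ for all $0\le t\le R$ and all unit vectors $u\in T_z\mathbb{M}$ with $\langle u,w\rangle\ge\cos\theta$. $h_X:=\max_{x\in\Omega}\mathrm{dist}(x,X)$; $\|\vec c\|_{\ell_\infty(X)}=\max_j|c_j|$; $C(\Omega)$ carries the sup norm. $C^{k+1}(\Omega)$ is the space of restrictions to $\Omega$ of functions in $C^{k+1}(\mathbb{M})$, with norm $\|f\|_{C^{k+1}(\Omega)}=\inf\{\|F\|_{C^{k+1}(\mathbb{M})}:F|_\Omega=f\}$. $\mathcal{P}_k=\mathcal{P}_k(\mathbb{R}^d)$ is the space of polynomials on $\mathbb{R}^d$ of degree at most $k$. $\varTheta_k$ denotes a constant (depending on $k$ and on $\mathbb{M}$ and the cone parameters of $\Omega$) which, together with a constant $\Gamma_k>0$, has the known property that for every $\epsilon>0$ and every finite $X\subset\Omega$ with $h_X<\Gamma_k\epsilon$ there is a family of smooth functions $a(x_j,\cdot):\Omega\to\mathbb{R}$ (a local polynomial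 reproduction of degree $k$) with $\sum_ja(x_j,z)p(x_j)=p(z)$ for all $p\in\mathcal{P}_k$ and $z\in\Omega$, $\sum_j|a(x_j,z)|\le1+\epsilon$, and $a(x_j,z)=0$ for $x_j\notin B(z,\varTheta_kh_X/\epsilon)$. Definition of $\mathcal{T}_X$: for $z\in\Omega$ put $X_z:=X\cap B(z,\varTheta_kh_X/\epsilon)$. Set $a^*(x_j,z)=0$ for $x_j\notin X_z$, and let $$a^*(\cdot,z)|_{X_z}:=\arg\min\sum_{x_j\in X_z}|a_j|\quad\text{subject to}\quad V_za=p_z,$$ where $V_z$ is the Vandermonde matrix of a basis $(p_1,\dots,p_M)$ of $\mathcal{P}_k$ on the local centers $X_z$ and $p_z=(p_i(z))_{i\le M}$ (that is, the constraint is $\sum_{x_j\in X_z}a_jp_i(x_j)=p_i(z)$ for all $i\le M$). Then $$\mathcal{T}_X\vec c(z):=\sum_{j=1}^Na^*(x_j,z)\,c_j,\qquad z\in\Omega.$$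
   Formalization: T_X c need not be continuous (it can jump when X_z changes), so T_X maps into bounded functions, for every choice of minimizers, rather than C(Ω); and ε ranges over 0<ε<ε_0, where Θ_k's reproduction property holds, since for ε>Θ_k some X_z can be empty. *)

(* Defs.v *)
From HB Require Import structures.
From mathcomp Require Import all_boot all_order all_algebra.
From mathcomp Require Import all_classical all_reals all_analysis.
From mathcomp.multinomials Require Import -(notations) mpoly.
Set Implicit Arguments.
Unset Strict Implicit.
Unset Printing Implicit Defensive.
Import Order.TTheory GRing.Theory Num.Theory.
Import numFieldNormedType.Exports.
Local Open Scope classical_set_scope.
Local Open Scope ring_scope.

(* The library norm [`|x|] of a row vector is the max norm; the Riemannian
   metric needs the Euclidean one. *)
Definition dot {R : realType} {d : nat} (u v : 'rV[R]_d) : R :=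
  \sum_i u ord0 i * v ord0 i.

Definition enorm {R : realType} {d : nat} (u : 'rV[R]_d) : R :=
  Num.sqrt (dot u u).

Definition poly_eval {R : realType} {d : nat} (p : mpoly.mpoly d R)
  (x : 'rV[R]_d) : R := mpoly.meval (x ord0) p.

(* [mmeasure mdeg] is 1 + total degree, and 0 for the zero polynomial. *)
Definition poly_le {R : realType} {d : nat} (k : nat) : set (mpoly.mpoly d R) :=
  [set p | (mpoly.mmeasure mpoly.mdeg p <= k.+1)%N].

Definition poly_basis {R : realType} {d : nat} (k : nat) (q : nat)
    (b : 'I_q -> mpoly.mpoly d R) : Prop :=
  (forall i, poly_le k (b i)) /\
  (forall p, poly_le k p -> exists! c : 'rV[R]_q, p = \sum_i c ord0 i *: b i).

(* [pderiv [:: i1; ...; ir] f] is the iterated partial derivative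
   D_i1 ... D_ir f. *)
Definition pderiv {R : realType} {m : nat} {W : normedModType R}
    (s : seq 'I_m) (f : 'rV[R]_m -> W) : 'rV[R]_m -> W :=
  foldr (fun i g => fun x => 'D_(delta_mx ord0 i) g x) f s.

(* Meant for open [V]: all iterated partial derivatives up to order [n] exist
   and are continuous on [V]. *)
Definition Cn {R : realType} {m : nat} {W : normedModType R} (n : nat)
    (V : set 'rV[R]_m) (f : 'rV[R]_m -> W) : Prop :=
  (forall s : seq 'I_m, (size s <= n)%N ->
     forall x, V x -> {for x, continuous (pderiv s f)}) /\
  (forall s : seq 'I_m, (size s < n)%N ->
     forall x i, V x -> derivable (pderiv s f) x (delta_mx ord0 i)).

Definition Cinf {R : realType} {m : nat} {W : normedModType R}
    (V : set 'rV[R]_m) (f : 'rV[R]_m -> W) : Prop := forall n, Cn n V f.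

(* [phi] is a diffeomorphism of the open set [V] onto the relatively open
   subset [phi @` V] of [M]: its inverse is the restriction of a smooth map
   [psi] defined on an open subset of the ambient space. *)
Definition local_param {R : realType} {d m : nat} (M : set 'rV[R]_d)
    (V : set 'rV[R]_m) (phi : 'rV[R]_m -> 'rV[R]_d) : Prop :=
  [/\ open V, Cinf V phi &
    exists (U : set 'rV[R]_d) (psi : 'rV[R]_d -> 'rV[R]_m),
      [/\ open U, Cinf U psi, phi @` V = M `&` U &
          forall y, V y -> psi (phi y) = y]].

Definition embedded_submanifold {R : realType} {d : nat} (m : nat)
    (M : set 'rV[R]_d) : Prop :=
  forall p, M p -> exists (V : set 'rV[R]_m) (phi : 'rV[R]_m -> 'rV[R]_d),
    local_param M V phi /\ (phi @` V) p.

Definition algebraic_set {R : realType} {d : nat} (A : set 'rV[R]_d) : Prop :=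
  exists s : seq (mpoly.mpoly d R),
    A = [set x | forall p, p \in s -> poly_eval p x = 0].

Definition irreducible_algebraic {R : realType} {d : nat}
    (A : set 'rV[R]_d) : Prop :=
  [/\ algebraic_set A, A !=set0 &
      forall B C, algebraic_set B -> algebraic_set C ->
        A = B `|` C -> A = B \/ A = C].

Definition irreducible_chain {R : realType} {d : nat} (A : set 'rV[R]_d)
    (n : nat) : Prop :=
  exists Z : nat -> set 'rV[R]_d,
    (forall i, (i <= n)%N -> irreducible_algebraic (Z i) /\ Z i `<=` A) /\
    (forall i, (i < n)%N -> Z i `<` Z i.+1).

(* The dimension is the Krull dimension for the Zariski topology. *)
Definition algebraic_dim {R : realType} {d : nat} (A : set 'rV[R]_d)
    (n : nat) : Prop :=
  irreducible_chain A n /\ ~ irreducible_chain A n.+1.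

Definition algebraic_manifold {R : realType} {d : nat} (m : nat)
    (M : set 'rV[R]_d) : Prop :=
  [/\ compact M, embedded_submanifold m M &
      exists A, [/\ algebraic_set A, algebraic_dim A m & M `<=` A]].

Definition smooth_curve {R : realType} {d : nat} (g : R -> 'rV[R]_d) : Prop :=
  forall n t, derivable (derive1n n g) t 1.

Definition tangent {R : realType} {d : nat} (M : set 'rV[R]_d)
    (z : 'rV[R]_d) : set 'rV[R]_d :=
  [set v | exists g : R -> 'rV[R]_d,
     [/\ smooth_curve g, forall t, M (g t), g 0 = z & derive1 g 0 = v]].

Definition curve_length {R : realType} {d : nat} (g : R -> 'rV[R]_d) : \bar R :=
  (\int[lebesgue_measure]_(t in `[0%R, 1%R]) (enorm (derive1 g t))%:E)%E.

(* A piecewise smooth curve in [M] from [x] to [y]: the [i]-th piece is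
   [g i] restricted to [0, 1], and each piece starts where the previous one
   ends. Only [g i] restricted to [0, 1] has to lie in [M]. *)
Definition piecewise_path {R : realType} {d : nat} (M : set 'rV[R]_d)
    (x y : 'rV[R]_d) (n : nat) (g : nat -> R -> 'rV[R]_d) : Prop :=
  [/\ forall i, (i <= n)%N ->
        smooth_curve (g i) /\ (forall t, 0 <= t <= 1 -> M (g i t)),
      g 0%N 0 = x, g n 1 = y &
      forall i, (i < n)%N -> g i 1 = g i.+1 0].

(* The distance is +oo between different connected components. *)
Definition rdist {R : realType} {d : nat} (M : set 'rV[R]_d)
    (x y : 'rV[R]_d) : \bar R :=
  ereal_inf [set l : \bar R |
    exists (n : nat) (g : nat -> R -> 'rV[R]_d),
      piecewise_path M x y n g /\
      l = (\sum_(0 <= i < n.+1) curve_length (g i))%E].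

Definition rball {R : realType} {d : nat} (M : set 'rV[R]_d)
    (z : 'rV[R]_d) (r : R) : set 'rV[R]_d :=
  [set x | M x /\ (rdist M z x < r%:E)%E].

(* The covariant derivative of g' along g is the tangential part of g'', so
   geodesics are the curves whose acceleration is normal to [M]. *)
Definition geodesic {R : realType} {d : nat} (M : set 'rV[R]_d)
    (g : R -> 'rV[R]_d) : Prop :=
  [/\ smooth_curve g, forall t, M (g t) &
      forall t v, tangent M (g t) v -> dot (derive1n 2 g t) v = 0].

(* [exp_map M z v] is the value at time 1 of the geodesic with position [z] and
   velocity [v] at time 0; it is unique, and defined for all tangent [v] when
   [M] is compact. *)
Definition exp_map {R : realType} {d : nat} (M : set 'rV[R]_d)
    (z v : 'rV[R]_d) : 'rV[R]_d :=
  xget z [set y | exists g : R -> 'rV[R]_d,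
     [/\ geodesic M g, g 0 = z, derive1 g 0 = v & g 1 = y]].

Definition cone_condition {R : realType} {d : nat} (M Omega : set 'rV[R]_d)
    : Prop :=
  exists r theta : R, [/\ 0 < r, 0 < theta < pi / 2 &
    forall z, Omega z ->
      exists w, [/\ tangent M z w, enorm w = 1 &
        forall (t : R) (u : 'rV[R]_d), 0 <= t <= r ->
          tangent M z u -> enorm u = 1 -> cos theta <= dot u w ->
          Omega (exp_map M z (t *: u))]].

(* Functions on subsets of R^d are represented by total functions of which
   only the values on the subset matter. *)
Definition Cn_mfd {R : realType} {d : nat} (m n : nat) (M : set 'rV[R]_d)
    (F : 'rV[R]_d -> R) : Prop :=
  forall (V : set 'rV[R]_m) (phi : 'rV[R]_m -> 'rV[R]_d),
    local_param M V phi -> Cn n V (F \o phi : 'rV[R]_m -> R^o).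

(* The norm of C^n(M) is defined, up to equivalence, by a finite family of local
   parametrizations together with compact subsets of their domains whose
   interiors still cover [M]. *)
Record chart (R : realType) (d m : nat) := Chart {
  chart_dom : set 'rV[R]_m;
  chart_core : set 'rV[R]_m;
  chart_map : 'rV[R]_m -> 'rV[R]_d }.

Definition atlas {R : realType} {d m q : nat} (M : set 'rV[R]_d)
    (A : 'I_q -> chart R d m) : Prop :=
  (forall i, [/\ local_param M (chart_dom (A i)) (chart_map (A i)),
                 compact (chart_core (A i)) &
                 chart_core (A i) `<=` chart_dom (A i)]) /\
  M `<=` \bigcup_i (chart_map (A i) @` interior (chart_core (A i))).

Definition Cn_mfd_norm {R : realType} {d m q : nat} (A : 'I_q -> chart R d m)
    (n : nat) (F : 'rV[R]_d -> R) : \bar R :=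
  ereal_sup [set e : \bar R | exists (i : 'I_q) (s : seq 'I_m) (y : 'rV[R]_m),
    [/\ (size s <= n)%N, chart_core (A i) y &
        e = (`|pderiv s (F \o chart_map (A i) : 'rV[R]_m -> R^o) y|)%:E]].

Definition extends {R : realType} {d : nat} (Omega : set 'rV[R]_d)
    (F f : 'rV[R]_d -> R) : Prop := forall z, Omega z -> F z = f z.

Definition Cn_on {R : realType} {d : nat} (m n : nat) (M Omega : set 'rV[R]_d)
    (f : 'rV[R]_d -> R) : Prop :=
  exists F, Cn_mfd m n M F /\ extends Omega F f.

Definition Cn_on_norm {R : realType} {d m q : nat} (M : set 'rV[R]_d)
    (A : 'I_q -> chart R d m) (Omega : set 'rV[R]_d) (n : nat)
    (f : 'rV[R]_d -> R) : \bar R :=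
  ereal_inf [set Cn_mfd_norm A n F |
             F in [set F | Cn_mfd m n M F /\ extends Omega F f]].

Definition Cinf_on {R : realType} {d : nat} (m : nat) (M Omega : set 'rV[R]_d)
    (f : 'rV[R]_d -> R) : Prop :=
  exists F, (forall n, Cn_mfd m n M F) /\ extends Omega F f.

(* For empty [Omega] this is -oo. *)
Definition sup_norm {R : realType} {d : nat} (Omega : set 'rV[R]_d)
    (f : 'rV[R]_d -> R) : \bar R :=
  ereal_sup [set (`|f z|)%:E | z in Omega].

Definition fill_dist {R : realType} {d N : nat} (M Omega : set 'rV[R]_d)
    (X : 'I_N -> 'rV[R]_d) : \bar R :=
  ereal_sup [set ereal_inf [set rdist M x (X j) | j in setT] | x in Omega].

Definition local_radius {R : realType} {d N : nat} (M Omega : set 'rV[R]_d)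
    (Theta eps : R) (X : 'I_N -> 'rV[R]_d) : R :=
  Theta * fine (fill_dist M Omega X) / eps.

Definition local_centers {R : realType} {d N : nat} (M Omega : set 'rV[R]_d)
    (Theta eps : R) (X : 'I_N -> 'rV[R]_d) (z : 'rV[R]_d) : set 'rV[R]_d :=
  range X `&` rball M z (local_radius M Omega Theta eps X).

Definition local_reproduction {R : realType} {d N : nat} (m k : nat)
    (M Omega : set 'rV[R]_d) (Theta eps : R) (X : 'I_N -> 'rV[R]_d)
    (a : 'I_N -> 'rV[R]_d -> R) : Prop :=
  (forall j, Cinf_on m M Omega (a j)) /\
  (forall z, Omega z ->
     [/\ forall p, poly_le k p ->
           \sum_j a j z * poly_eval p (X j) = poly_eval p z,
         \sum_j `|a j z| <= 1 + eps &
         forall j, ~ rball M z (local_radius M Omega Theta eps X) (X j) ->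
           a j z = 0]).

(* The range of [eps] is restricted to 0 < eps < eps0, where [eps0] may be +oo:
   for eps > Theta the radius Theta h_X / eps is smaller than h_X, so that some
   ball contains no center and not even constants can be reproduced. *)
Definition reproduction_constant {R : realType} {d : nat} (m k : nat)
    (M Omega : set 'rV[R]_d) (Theta : R) (eps0 : \bar R) : Prop :=
  exists2 Gamma : R, 0 < Gamma &
    forall (eps : R) (N : nat) (X : 'I_N -> 'rV[R]_d),
      0 < eps -> (eps%:E < eps0)%E -> injective X -> (forall j, Omega (X j)) ->
      (fill_dist M Omega X < (Gamma * eps)%:E)%E ->
      exists a, local_reproduction m k M Omega Theta eps X a.

(* [V_z a = p_z] for the basis [b], with [a] extended by 0 off the local
   centers. *)
Definition feasible {R : realType} {d N q : nat} (b : 'I_q -> mpoly.mpoly d R)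
    (X : 'I_N -> 'rV[R]_d) (Xz : set 'rV[R]_d) (z : 'rV[R]_d)
    (a : 'I_N -> R) : Prop :=
  (forall j, X j \notin Xz -> a j = 0) /\
  (forall i, \sum_(j < N | X j \in Xz) a j * poly_eval (b i) (X j) =
             poly_eval (b i) z).

Definition l1_minimizer {R : realType} {d N q : nat}
    (b : 'I_q -> mpoly.mpoly d R) (X : 'I_N -> 'rV[R]_d) (Xz : set 'rV[R]_d)
    (z : 'rV[R]_d) (a : 'I_N -> R) : Prop :=
  feasible b X Xz z a /\
  forall a', feasible b X Xz z a' ->
    \sum_(j < N | X j \in Xz) `|a j| <= \sum_(j < N | X j \in Xz) `|a' j|.

Definition T_op {R : realType} {d N : nat} (a : 'I_N -> 'rV[R]_d -> R)
    (c : 'rV[R]_N) : 'rV[R]_d -> R :=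
  fun z => \sum_j a j z * c ord0 j.

Definition sampling {R : realType} {d N : nat} (X : 'I_N -> 'rV[R]_d)
    (f : 'rV[R]_d -> R) : 'rV[R]_N := \row_j f (X j).

(* Main.v *)
Require Import Defs.
From HB Require Import structures.
From mathcomp Require Import all_boot all_order all_algebra.
From mathcomp Require Import all_classical all_reals all_analysis.
From mathcomp.multinomials Require Import -(notations) mpoly.
From mathcomp Require Import measurable_realfun zify ring lra.
Set Implicit Arguments.
Unset Strict Implicit.
Unset Printing Implicit Defensive.
Import Order.TTheory GRing.Theory Num.Theory.
Import numFieldNormedType.Exports.
Local Open Scope classical_set_scope.
Local Open Scope ring_scope.

(** Everything rests on one local fact: for [z] in the compact manifold [M], a
    function [F] of class C^(k+1) on [M] agrees with the restriction of an
    ambient polynomial of degree at most [k] up to [L * B * rho ^+ k.+1] on the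
    points of [M] at distance less than [rho] from [z], where [B] bounds the
    C^(k+1)-norm of [F] and [L] depends only on [M], its atlas and [k]
    ([poly_approx_uniform]).

    Given this, let [h] be the fill distance and [p] that polynomial for
    [rho = Theta * h / eps]. An l1-minimizer [a] reproduces [p], so the error at
    [z] is
    [\sum_j a j * (F - p) (X j) - (F - p) z], where only centers in the ball of
    radius [rho] about [z] contribute. Riemannian distance dominates the
    sup-norm distance ([rdist_ge]), so the local fact applies to them. The
    smooth local reproduction is a competitor in the minimization, hence
    [\sum_j `|a j| <= 1 + eps], which is the stability bound and leaves an error
    of at most [(2 + eps) * L * B * rho ^+ k.+1]
    ([quasi_interpolation_error]). Finally [2 + eps <= 2 + Theta]: reproducing
    the constant 1 puts a center in each ball of radius [Theta * h / eps], so
    [0 < h <= Theta * h / eps] ([fill_dist_pos]).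

    For the local fact, write [F] near a point as [G \o g], where [g] is the
    smooth ambient left inverse of a parametrization and [G] is [F] in the
    chart. Rather than differentiate a composite [k.+1] times, one composes
    expansions. A [jet_on] is a Taylor expansion whose terms are graded by
    order of vanishing at [z]. Such expansions are stable under sums and
    products, hence under substitution in a Taylor polynomial
    ([jet_on_comp]). That lemma is used twice: substituting the coordinate
    functions gives jets of the coordinates of [g] ([smooth_jets]), and
    substituting these gives a jet of [G \o g] ([manifold_jet]). The constants
    depend only on bounds for derivatives near the point, so a covering argument
    makes them uniform over [M]. *)

(** * Directional derivatives *)

Section DirectionalDerivatives.
Context {R : realType} {V W : normedModType R}.
Implicit Types (f : V -> W) (x z v : V).

Lemma is_deriveP f x v (df : W) :
  is_derive x v f df <->
  (fun h : R => h^-1 *: (f (h *: v + x) - f x)) @ 0^' --> df.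
Proof.
split=> [[fxv <-] //|fdf]; apply: DeriveDef; first exact: cvgP fdf.
exact: cvg_lim fdf.
Qed.

Lemma is_derive_line f z v (t : R) (df : W) :
  is_derive (t *: v + z) v f df -> is_derive t 1 (fun t => f (t *: v + z)) df.
Proof.
move=> [fdf <-].
have E : (fun h : R => h^-1 *: (((fun t => f (t *: v + z)) \o shift t)
                                  (h *: (1 : R)) - f (t *: v + z)))
  = (fun h : R => h^-1 *:
      ((f \o shift (t *: v + z)) (h *: v) - f (t *: v + z))).
  apply/funext => h /=.
  by rewrite (_ : h *: (1 : R) = h) ?scalerDl ?addrA //; exact: mulr1.
by apply: DeriveDef; rewrite /derivable /derive E.
Qed.

Lemma is_derive_scale_dir f x v (c : R) (df : W) :
  is_derive x v f df -> is_derive x (c *: v) f (c *: df).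
Proof.
move=> /is_deriveP fdf; have [->|c0] := eqVneq c 0.
  by rewrite !scale0r; exact: is_derive0.
apply/is_deriveP.
rewrite (_ : (fun h => _) = (fun h : R => c *:
    ((h * c)^-1 *: (f ((h * c) *: v + x) - f x)))); last first.
  apply/funext => h; rewrite scalerA scalerA; have [->|h0] := eqVneq h 0.
    by rewrite mul0r !invr0 mulr0 !scale0r.
  by rewrite invfM mulrCA divff// mulr1.
apply: cvgZl_tmp.
have hc : (fun h : R => h * c) @ 0^' --> 0^'.
  move=> P [e /= e0 eP]; exists (e / `|c|) => /=.
    by rewrite divr_gt0 // normr_gt0.
  move=> h /=; rewrite sub0r normrN => he h0; apply: eP => /=.
    by rewrite sub0r normrN normrM -ltr_pdivlMr // normr_gt0.
  by rewrite mulf_neq0.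
exact: (cvg_comp _ _ hc fdf).
Qed.
End DirectionalDerivatives.

Lemma line_MVT {R : realType} {V : normedModType R} (f df : V -> R^o)
    (z v : V) :
  (forall t : R, 0 <= t <= 1 -> is_derive (t *: v + z) v f (df (t *: v + z))) ->
  exists2 t : R, 0 <= t <= 1 & f (v + z) - f z = df (t *: v + z).
Proof.
move=> fdf.
have [||t] := @MVT_segment R (fun t => f (t *: v + z))
    (fun t => df (t *: v + z)) 0 1 ler01.
- move=> t /[!in_itv]/= /andP[t0 t1]; apply: is_derive_line; apply: fdf.
  by rewrite !ltW.
- apply: derivable_within_continuous => t /[!in_itv]/= t01.
  by have [] := is_derive_line (fdf t t01).
- rewrite in_itv /= => t01; rewrite scale1r scale0r add0r subr0 mulr1 => ->.
  by exists t.
Qed.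

(** Go from [x] to [x + h (u + w)] through [x + h w]. By the mean value theorem
    [f] grows by [h du(y)] along the second leg, for some [y] on it, and [du] is
    continuous at [x]. *)
Lemma is_derive_add_dir {R : realType} {V : normedModType R} (f : V -> R^o)
    (du : V -> R^o) (x u w : V) (dw : R^o) :
  (\forall y \near x, is_derive y u f (du y)) -> {for x, continuous du} ->
  is_derive x w f dw -> is_derive x (u + w) f (du x + dw).
Proof.
move=> fu cfu /is_deriveP fw; apply/is_deriveP.
apply/cvgrPdist_le => /= e e0.
have e20 : 0 < e / 2 by rewrite divr_gt0.
move/cvgrPdist_le : fw => /(_ _ e20) fw.
move/cvgrPdist_le : cfu => /(_ _ e20) cfu.
have /nbhs_ballP[r /= r0 rP] : nbhs x (fun y => is_derive y u f (du y) /\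
   `|du x - du y| <= e / 2) by apply: filterI.
near=> h.
have h0 : h != 0 by near: h; exact: nbhs_dnbhs_neq.
have hr : `|h| * (`|u| + `|w| + 1) < r.
  rewrite -ltr_pdivlMr; last by rewrite ltr_wpDl // addr_ge0.
  by near: h; apply: dnbhs0_lt; rewrite divr_gt0 // ltr_wpDl // addr_ge0.
have near_x y : `|y - x| <= `|h| * (`|u| + `|w|) ->
    is_derive y u f (du y) /\ `|du x - du y| <= e / 2.
  move=> yx; apply: rP; rewrite -ball_normE /= distrC.
  by apply: le_lt_trans yx (le_lt_trans _ hr); rewrite ler_wpM2l // lerDl.
have [t /andP[t0 t1] ft] : exists2 t : R, 0 <= t <= 1 &
    f (h *: u + (h *: w + x)) - f (h *: w + x) =
    h *: du (t *: (h *: u) + (h *: w + x)).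
  apply: (@line_MVT R V f (fun y => h *: du y)) => t /andP[t0 t1].
  apply: is_derive_scale_dir; apply: (proj1 (near_x _ _)).
  rewrite addrA addrK mulrDr (le_trans (ler_normD _ _)) // !normrZ lerD //.
  by rewrite (ger0_norm t0) ler_piMl // mulr_ge0.
have -> : du x + dw - h^-1 *: (f (h *: (u + w) + x) - f x) =
    (du x - du (t *: (h *: u) + (h *: w + x))) +
    (dw - h^-1 *: (f (h *: w + x) - f x)).
  have -> : f (h *: (u + w) + x) - f x =
    h *: du (t *: (h *: u) + (h *: w + x)) + (f (h *: w + x) - f x).
    by rewrite -ft subrKA scalerDr -addrA.
  set D := du (t *: _ + _); rewrite scalerDr scalerA mulVf // scale1r opprD.
  by rewrite !addrA; congr (_ - _); rewrite addrAC.
rewrite (splitr e) (le_trans (ler_normD _ _)) // lerD //.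
  apply: (proj2 (near_x _ _)).
  rewrite addrA addrK mulrDr (le_trans (ler_normD _ _)) // !normrZ lerD //.
  by rewrite (ger0_norm t0) ler_piMl // mulr_ge0.
by near: h.
Unshelve. all: by end_near. Qed.

(** Continuity of the partial derivatives is what makes the directional
    derivatives depend linearly on the direction; the coordinates of [v] are
    added one at a time. *)
Lemma is_derive_sum_dir {R : realType} {m : nat} (f : 'rV[R]_m -> R^o)
    (x v : 'rV[R]_m) :
  (forall i, \forall y \near x, derivable f y (delta_mx ord0 i)) ->
  (forall i, {for x, continuous (fun y => 'D_(delta_mx ord0 i) f y)}) ->
  is_derive x v f (\sum_i v ord0 i * 'D_(delta_mx ord0 i) f x).
Proof.
move=> df cf; rewrite {1}(row_sum_delta v).
elim: (index_enum _) => [|i r IH]; first by rewrite !big_nil; exact: is_derive0.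
rewrite !big_cons.
apply: (@is_derive_add_dir _ _ f
  (fun y => v ord0 i * 'D_(delta_mx ord0 i) f y)) => //.
  apply: filterS (df i) => y fy; apply: is_derive_scale_dir.
  exact: DeriveDef.
exact: (continuous_comp (cf i) (@mulrl_continuous R _ _)).
Qed.

(** * Taylor expansion in several variables *)

Lemma ball_segment {R : realType} {V : normedModType R} (c z v : V) (r t : R) :
  ball c r z -> ball c r (v + z) -> 0 <= t <= 1 -> ball c r (t *: v + z).
Proof.
rewrite -!ball_normE /= => cz cvz /andP[t0 t1].
have -> : c - (t *: v + z) = t *: (c - (v + z)) + (1 - t) *: (c - z).
  have E w : c - (w + z) = (c - z) - w by rewrite opprD addrA addrAC.
  by rewrite !E scalerBr scalerBl scale1r [RHS]addrC subrKA.
rewrite (le_lt_trans (ler_normD _ _)) // !normrZ.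
rewrite ger0_norm // [`|1 - t|]ger0_norm ?subr_ge0 //.
have := t0; rewrite le_eqVlt => /predU1P[<-|t0'].
  by rewrite mul0r subr0 mul1r add0r.
rewrite [ltRHS](_ : r = t * r + (1 - t) * r); last first.
  by rewrite -mulrDl subrKC mul1r.
by rewrite ltr_leD // ?ltr_pM2l // ler_wpM2l ?subr_ge0 // ltW.
Qed.

Lemma rV_coord_le {R : realType} {m : nat} (v : 'rV[R]_m) i :
  `|v ord0 i| <= `|v|.
Proof.
rewrite [leRHS]/Num.Def.normr /= mx_normrE.
exact: (le_bigmax _ (fun j : 'I_1 * 'I_m => `|v j.1 j.2|) (ord0, i)).
Qed.

(** The [j]-th derivative at [0] of [t |-> pderiv s f (t *: v + z)]. The index
    [i] is pushed in front of [s] because [pderiv (i :: s) f] is the derivative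
    of [pderiv s f]; this makes the induction on [j] run over all [s] at once,
    without multi-indices or symmetry of mixed derivatives. *)
Fixpoint taylor_term {R : realType} {m : nat} (f : 'rV[R]_m -> R^o)
    (z v : 'rV[R]_m) (j : nat) (s : seq 'I_m) : R :=
  if j is j'.+1 then \sum_i v ord0 i * taylor_term f z v j' (i :: s)
  else pderiv s f z.

Definition taylor_poly {R : realType} {m : nat} (f : 'rV[R]_m -> R^o)
    (z v : 'rV[R]_m) (j : nat) (s : seq 'I_m) : {poly R} :=
  \poly_(l < j) ((l`!)%:R^-1 * taylor_term f z v l s).

Lemma deriv_taylor_poly {R : realType} {m : nat} (f : 'rV[R]_m -> R^o)
    (z v : 'rV[R]_m) (j : nat) (s : seq 'I_m) :
  (taylor_poly f z v j.+1 s)^`() =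
  \sum_i v ord0 i *: taylor_poly f z v j (i :: s).
Proof.
apply/polyP => l; rewrite coef_deriv coef_sum coef_poly ltnS.
under eq_bigr do rewrite coefZ coef_poly.
case: ifP => lj; last by rewrite mul0rn big1 // => i _; rewrite mulr0.
rewrite -mulrnAl factS natrM invfM -mulrnAl -[_ *+ l.+1]mulr_natl divff //.
by rewrite mul1r /= mulr_sumr; apply: eq_bigr => i _; rewrite mulrCA.
Qed.

(** The remainder of order [j.+1] of [pderiv s f] vanishes at [t = 0], and its
    derivative in [t] is the combination with weights [v ord0 i] of the
    remainders of order [j] of the [pderiv (i :: s) f]. The mean value theorem
    thus gains one factor [m%:R * `|v|] at each order; the constant is not
    optimal, but it depends on [m] and [j] only. *)
Lemma taylor_remainder {R : realType} {m n : nat} (f : 'rV[R]_m -> R^o)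
    (V : set 'rV[R]_m) (c : 'rV[R]_m) (r B : R) :
  open V -> Cn n V f -> ball c r `<=` V ->
  (forall s y, (size s <= n)%N -> ball c r y -> `|pderiv s f y| <= B) ->
  forall z v, ball c r z -> ball c r (v + z) ->
  forall j s (t : R), (size s + j <= n)%N -> 0 <= t <= 1 ->
  `|pderiv s f (t *: v + z) - (taylor_poly f z v j s).[t]|
    <= B * (m%:R * `|v|) ^+ j.
Proof.
move=> oV [cf df] cV fB z v cz cvz; elim=> [|j IH] s t sj t01.
  rewrite /taylor_poly poly_def big_ord0 horner0 subr0 expr0 mulr1.
  by apply: fB; [rewrite addn0 in sj|apply: ball_segment].
have [t0 t1] := andP t01.
pose g (u : R) : R := pderiv s f (u *: v + z) - (taylor_poly f z v j.+1 s).[u].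
pose dg (u : R) : R := \sum_i v ord0 i * (pderiv (i :: s) f (u *: v + z) -
  (taylor_poly f z v j (i :: s)).[u]).
have gdg (u : R) : 0 <= u <= 1 -> is_derive u 1 g (dg u).
  move=> u01.
  have -> : dg u = \sum_i v ord0 i * pderiv (i :: s) f (u *: v + z) -
      (taylor_poly f z v j.+1 s)^`().[u].
    rewrite deriv_taylor_poly horner_sum /dg -sumrB; apply: eq_bigr => i _.
    by rewrite hornerZ mulrBr.
  apply: is_deriveB; apply: is_derive_line.
  have Vu : V (u *: v + z) by apply/cV/ball_segment.
  apply: is_derive_sum_dir => i.
    apply: filterS (open_nbhs_nbhs (conj oV Vu)) => y Vy; apply: df => //.
    by apply: leq_trans sj; rewrite addnS ltnS leq_addr.
  apply: (cf (i :: s)) => //=.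
  by apply: leq_trans sj; rewrite addnS ltnS leq_addr.
have g0 : g 0 = 0.
  by rewrite /g horner_coef0 coef_poly /= invr1 mul1r scale0r add0r subrr.
have [||w] := @MVT_segment R g dg 0 t t0.
- move=> u /[!in_itv]/= /andP[u0 ut]; apply: gdg.
  by rewrite ltW //= (le_trans (ltW ut)).
- apply: derivable_within_continuous => u /[!in_itv]/= /andP[u0 ut].
  by have [] : is_derive u 1 g (dg u) by apply: gdg; rewrite u0 (le_trans ut).
rewrite in_itv /= => /andP[w0 wt].
rewrite g0 !subr0 -/(g t) => ->.
rewrite normrM (ger0_norm t0) exprS mulrA.
apply: (@le_trans _ _ `|dg w|); first by rewrite ler_piMr.
rewrite (le_trans (ler_norm_sum _ _ _)) //.
apply: (@le_trans _ _ (\sum_(i < m) `|v| * (B * (m%:R * `|v|) ^+ j))).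
  apply: ler_sum => i _; rewrite normrM ler_pM ?rV_coord_le //.
  apply: IH; first by rewrite /= addSnnS.
  by rewrite w0 (le_trans wt).
rewrite sumr_const card_ord -mulr_natl le_eqVlt; apply/orP; left; apply/eqP.
by ring.
Qed.

(** * Expansions graded by order of vanishing *)

Section PolynomialFunctions.
Context {R : realType} {d : nat}.
Implicit Types (f g : 'rV[R]_d -> R) (k : nat).

(** Working with functions instead of formal polynomials makes the closure
    properties below statements about pointwise operations. *)
Definition polyfun k f : Prop := exists2 p, poly_le k p & f =1 poly_eval p.

Lemma polyfun_le k l f : (k <= l)%N -> polyfun k f -> polyfun l f.
Proof. by move=> kl [p pk fp]; exists p => //; apply: leq_trans pk _. Qed.

Lemma polyfun_cst k (c : R) : polyfun k (fun=> c).
Proof.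
exists (mpoly.mpolyC d c); last by move=> x; rewrite /poly_eval mevalC.
by rewrite /poly_le /= mmeasureC; case: (c != 0).
Qed.

Lemma polyfun_coord i : polyfun 1 (fun x => x ord0 i).
Proof.
exists (mpoly.mpolyX R (mnm1 i)); last by move=> x; rewrite /poly_eval mevalXU.
rewrite /poly_le /= mmeasureX; exact: eq_leq (congr1 S (mdeg1 i)).
Qed.

Lemma polyfunD k f g :
  polyfun k f -> polyfun k g -> polyfun k (fun x => f x + g x).
Proof.
move=> [p pk fp] [q qk gq]; exists (p + q).
  by apply: leq_trans (mmeasureD_le _ _ _) _; rewrite geq_max pk.
by move=> x; rewrite /poly_eval mevalD fp gq.
Qed.

Lemma polyfunM k l f g :
  polyfun k f -> polyfun l g -> polyfun (k + l) (fun x => f x * g x).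
Proof.
move=> [p pk fp] [q ql gq]; exists (p * q); last first.
  by move=> x; rewrite /poly_eval mevalM fp gq.
have [->|p0] := eqVneq p 0; first by rewrite mul0r /poly_le /= mmeasure0.
have [->|q0] := eqVneq q 0; first by rewrite mulr0 /poly_le /= mmeasure0.
rewrite /poly_le /= msizeM //.
move: pk ql; rewrite /poly_le /= => pk ql.
rewrite -subn1 leq_subLR; apply: leq_trans (leq_add pk ql) _.
by rewrite addSn addnS.
Qed.

Lemma polyfun_sum k (I : Type) (r : seq I) (P : pred I)
    (F : I -> 'rV[R]_d -> R) :
  (forall i, P i -> polyfun k (F i)) ->
  polyfun k (fun x => \sum_(i <- r | P i) F i x).
Proof.
move=> PF; elim: r => [|i r IH].
  rewrite (_ : (fun x => _) = fun=> 0); first exact: polyfun_cst.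
  by apply/funext => x; rewrite big_nil.
have [Pi|nPi] := boolP (P i); last first.
  rewrite (_ : (fun x => _) = fun x => \sum_(i <- r | P i) F i x) //.
  by apply/funext => x; rewrite big_cons (negPf nPi).
rewrite (_ : (fun x => _) = fun x => F i x + \sum_(i <- r | P i) F i x).
  by apply: polyfunD => //; exact: PF.
by apply/funext => x; rewrite big_cons Pi.
Qed.

End PolynomialFunctions.

Section Jets.
Context {R : realType} {d : nat} (k : nat) (S : set 'rV[R]_d) (z : 'rV[R]_d).
Implicit Types (f g : 'rV[R]_d -> R) (C : R).

(** A Taylor expansion of order [k] at [z], with the degree-[i] part replaced by
    any polynomial of degree at most [i] that is [O(`|x - z| ^+ i)]. The term of
    index [k.+1] is the remainder: it obeys the same size estimate but is not
    polynomial, so that products treat it like the other terms. *)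
Definition jet_on C f : Prop := exists F : nat -> 'rV[R]_d -> R,
  [/\ forall i, (i <= k)%N -> polyfun i (F i),
      forall i x, (i <= k.+1)%N -> S x -> `|F i x| <= C * `|x - z| ^+ i &
      forall x, S x -> f x = \sum_(i < k.+2) F i x].

Lemma eq_jet_on C f g :
  (forall x, S x -> f x = g x) -> jet_on C f -> jet_on C g.
Proof.
by move=> fg [F [F1 F2 F3]]; exists F; split=> // x Sx; rewrite -fg // F3.
Qed.

Lemma jet_on_le C C' f : C <= C' -> jet_on C f -> jet_on C' f.
Proof.
move=> CC [F [F1 F2 F3]]; exists F; split=> // i x ik Sx.
by rewrite (le_trans (F2 i x ik Sx)) // ler_wpM2r // exprn_ge0.
Qed.

Lemma jet_on_single C (i : nat) f : (i <= k.+1)%N -> 0 <= C ->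
  ((i <= k)%N -> polyfun i f) ->
  (forall x, S x -> `|f x| <= C * `|x - z| ^+ i) -> jet_on C f.
Proof.
move=> ik C0 pf fC; exists (fun j => if j == i then f else fun=> 0); split.
- move=> j jk; case: eqP => [ji|_]; last exact: polyfun_cst.
  by rewrite ji; apply: pf; rewrite -ji.
- move=> j x jk Sx; case: eqP => [->|_]; first exact: fC.
  by rewrite normr0 mulr_ge0 // exprn_ge0.
- move=> x Sx; rewrite (bigD1 (Ordinal (ik : (i < k.+2)%N))) //= eqxx.
  by rewrite big1 ?addr0 // => j /negPf; rewrite -val_eqE /= => ->.
Qed.

Lemma jet_on_cst C c : `|c| <= C -> jet_on C (fun=> c).
Proof.
move=> cC; apply: (@jet_on_single _ 0) => //.
- exact: le_trans cC.
- by move=> _; exact: polyfun_cst.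
- by move=> x _; rewrite expr0 mulr1.
Qed.

Lemma jet_onD C C' f g :
  jet_on C f -> jet_on C' g -> jet_on (C + C') (fun x => f x + g x).
Proof.
move=> [F [F1 F2 F3]] [G [G1 G2 G3]]; exists (fun i x => F i x + G i x); split.
- by move=> i ik; apply: polyfunD; [exact: F1|exact: G1].
- move=> i x ik Sx; rewrite (le_trans (ler_normD _ _)) // mulrDl lerD //.
    exact: F2.
  exact: G2.
- by move=> x Sx; rewrite F3 // G3 // big_split.
Qed.

Lemma jet_onZ C (a : R) f :
  jet_on C f -> jet_on (`|a| * C) (fun x => a * f x).
Proof.
move=> [F [F1 F2 F3]]; exists (fun i x => a * F i x); split.
- move=> i ik; rewrite -[i]add0n.
  by apply: polyfunM; [exact: polyfun_cst|exact: F1].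
- by move=> i x ik Sx; rewrite normrM -mulrA ler_wpM2l // F2.
- by move=> x Sx; rewrite F3 // mulr_sumr.
Qed.

Lemma jet_on_sum n (C : 'I_n -> R) (f : 'I_n -> 'rV[R]_d -> R) :
  (forall i, jet_on (C i) (f i)) ->
  jet_on (\sum_i C i) (fun x => \sum_i f i x).
Proof.
move=> jf; elim: (index_enum _) => [|i r IH].
  rewrite big_nil (_ : (fun x => _) = fun=> 0).
    by apply: jet_on_cst; rewrite normr0.
  by apply/funext => x; rewrite big_nil.
rewrite big_cons (_ : (fun x => _) = fun x => f i x + \sum_(i <- r) f i x).
  exact: jet_onD.
by apply/funext => x; rewrite big_cons.
Qed.

Hypothesis S1 : forall x, S x -> `|x - z| <= 1.

(** All products of total order above [k] go to the remainder: collecting the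
    pairs [(i, j)] by [minn (i + j) k.+1] yields a jet because
    [`|x - z| ^+ (i + j) <= `|x - z| ^+ k.+1] there, as [`|x - z| <= 1]. *)
Lemma jet_onM C C' f g : 0 <= C -> 0 <= C' ->
  jet_on C f -> jet_on C' g ->
  jet_on ((k.+2 * k.+2)%:R * (C * C')) (fun x => f x * g x).
Proof.
move=> C0 C'0 [F [F1 F2 F3]] [G [G1 G2 G3]].
pose deg (p : 'I_k.+2 * 'I_k.+2) : 'I_k.+2 := inord (minn (p.1 + p.2) k.+1).
have degE p : deg p = minn (p.1 + p.2) k.+1 :> nat.
  by rewrite inordK // ltnS geq_minr.
exists (fun l x => \sum_(p | deg p == l :> nat) F p.1 x * G p.2 x); split.
- move=> l lk; apply: polyfun_sum => -[i j] /=; rewrite degE /= => /eqP ijl.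
  have ij : (i + j = l)%N by move: ijl lk; lia.
  rewrite -ij; apply: polyfunM; [apply: F1|apply: G1]; lia.
- move=> l x lk Sx; rewrite (le_trans (ler_norm_sum _ _ _)) //.
  rewrite -mulrA mulr_natl.
  rewrite [(k.+2 * k.+2)%N](_ : _ = #|{: 'I_k.+2 * 'I_k.+2}|); last first.
    by rewrite card_prod !card_ord.
  rewrite -sumr_const big_mkcond /=; apply: ler_sum => -[i j] _ /=.
  case: ifPn => [|_]; last by rewrite !mulr_ge0 ?exprn_ge0.
  rewrite degE /= => /eqP ijl; rewrite normrM.
  apply: (@le_trans _ _ ((C * `|x - z| ^+ i) * (C' * `|x - z| ^+ j))).
    by rewrite ler_pM ?F2 ?G2 // -ltnS.
  rewrite mulrACA -exprD ler_wpM2l ?mulr_ge0 //.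
  by rewrite ler_wiXn2l ?S1 // -ijl geq_minl.
- move=> x Sx; rewrite F3 // G3 // big_distrlr /= pair_big /=.
  exact: (partition_big deg xpredT).
Qed.

End Jets.

Lemma jet_on_taylor_term {R : realType} {d m : nat} (k n : nat)
    (S : set 'rV[R]_d) (z : 'rV[R]_d) (f : 'rV[R]_m -> R^o) (z0 : 'rV[R]_m)
    (u : 'rV[R]_d -> 'rV[R]_m) (C B : R) :
  (forall x, S x -> `|x - z| <= 1) -> 0 <= C -> 0 <= B ->
  (forall i, jet_on k S z C (fun x => u x ord0 i)) ->
  (forall s, (size s <= n)%N -> `|pderiv s f z0| <= B) ->
  forall j s, (size s + j <= n)%N ->
  jet_on k S z (B * (m%:R * ((k.+2 * k.+2)%:R * C)) ^+ j)
    (fun x => taylor_term f z0 (u x) j s).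
Proof.
move=> S1 C0 B0 uC fB; elim=> [|j IH] s sj.
  by rewrite expr0 mulr1; apply: jet_on_cst; apply: fB; rewrite addn0 in sj.
set K := (m%:R * _) in IH *.
have K0 : 0 <= K by rewrite !mulr_ge0.
rewrite (_ : B * K ^+ j.+1 =
    \sum_(i < m) (k.+2 * k.+2)%:R * (C * (B * K ^+ j))).
  apply: jet_on_sum => i; apply: jet_onM => //.
    by rewrite mulr_ge0 // exprn_ge0.
  by apply: IH; rewrite /= addSnnS.
by rewrite sumr_const card_ord exprS -[RHS]mulr_natl /K; ring.
Qed.

(** In the Taylor polynomial of [f] at [w z], each monomial is a product of
    functions [x |-> (w x - w z) ord0 i], hence has a jet. The remainder of [f]
    is [O(`|w x - w z| ^+ k.+1)], which is [O(`|x - z| ^+ k.+1)]. The factor [K]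
    comes before [f], [w], [S] and [z], so it can be used uniformly in them. *)
Lemma jet_on_comp {R : realType} (d m k : nat) (C : R) : 0 <= C ->
  exists2 K : R, 0 <= K &
  forall (f : 'rV[R]_m -> R^o) (V : set 'rV[R]_m) (c : 'rV[R]_m) (r B : R)
    (w : 'rV[R]_d -> 'rV[R]_m) (S : set 'rV[R]_d) (z : 'rV[R]_d),
  open V -> Cn k.+1 V f -> ball c r `<=` V ->
  (forall s y, (size s <= k.+1)%N -> ball c r y -> `|pderiv s f y| <= B) ->
  ball c r (w z) -> (forall x, S x -> ball c r (w x)) ->
  (forall x, S x -> `|x - z| <= 1) ->
  (forall x, S x -> `|w x - w z| <= C * `|x - z|) ->
  (forall i, jet_on k S z C (fun x => (w x - w z) ord0 i)) ->
  jet_on k S z (K * B) (f \o w).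
Proof.
move=> C0; pose A : R := m%:R * ((k.+2 * k.+2)%:R * C).
exists (\sum_(l < k.+1) A ^+ l + (m%:R * C) ^+ k.+1).
  rewrite addr_ge0 ?exprn_ge0 ?mulr_ge0 //; apply: sumr_ge0 => l _.
  by rewrite exprn_ge0 // !mulr_ge0.
move=> f V c r B w S z oV fV cV fB cz cS S1 wC wJ.
have B0 : 0 <= B by apply: le_trans (fB [::] _ _ cz).
pose P x := \sum_(l < k.+1)
  (l`!)%:R^-1 * taylor_term f (w z) (w x - w z) l [::].
apply: (@eq_jet_on _ _ k S z _ (fun x => P x + (f (w x) - P x))).
  by move=> x _; rewrite addrC subrK.
rewrite mulrDl mulr_suml; apply: jet_onD.
  apply: jet_on_sum => l.
  apply: jet_on_le (jet_onZ _ (jet_on_taylor_term S1 C0 B0 wJ _ (n := k.+1) _)).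
  - rewrite [leRHS]mulrC ler_piMl ?mulr_ge0 ?exprn_ge0 ?mulr_ge0 //.
    by rewrite normfV normr_nat invf_le1 ?ltr0n ?fact_gt0 // ler1n fact_gt0.
  - by move=> s sk; apply: fB.
  - by rewrite add0n ltnW.
apply: (@jet_on_single _ _ _ _ _ _ k.+1) => //.
- by rewrite mulr_ge0 // exprn_ge0 // mulr_ge0.
- by rewrite ltnn.
move=> x Sx; have := taylor_remainder oV fV cV fB cz (v := w x - w z) _
  (j := k.+1) (s := [::]) (t := 1).
rewrite subrK => /(_ (cS x Sx) (leqnn _)); rewrite ler01 lexx => /(_ isT).
rewrite scale1r subrK horner_poly.
rewrite (_ : \sum_(l < k.+1) _ = P x); last first.
  by apply: eq_bigr => l _; rewrite expr1n mulr1.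
move=> /le_trans; apply.
rewrite mulrC -mulrA [B * _]mulrC mulrA ler_wpM2r //.
rewrite -exprMn lerXn2r ?nnegrE ?mulr_ge0 //.
by rewrite -mulrA ler_wpM2l // wC.
Qed.

(** * Jets of smooth maps *)

Lemma rV_norm_le {R : realType} {m : nat} (v : 'rV[R]_m) (B : R) :
  0 <= B -> (forall i, `|v ord0 i| <= B) -> `|v| <= B.
Proof.
move=> B0 vB; rewrite [leLHS]/Num.Def.normr /= mx_normrE.
apply: bigmax_le => //; by move=> [i j] _ /=; rewrite (ord1 i).
Qed.

Lemma pderiv_coord {R : realType} {d m n : nat} (U : set 'rV[R]_d)
    (g : 'rV[R]_d -> 'rV[R]_m) (i : 'I_m) : open U -> Cn n U g ->
  forall s x, (size s <= n)%N -> U x ->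
  pderiv s (fun x => g x ord0 i : R^o) x = pderiv s g x ord0 i.
Proof.
move=> oU [_ dg]; elim=> [//|a s IH] x sn Ux /=.
rewrite (derive_mx (dg s sn x a Ux)) mxE; apply: near_eq_derive.
apply: filterS (open_nbhs_nbhs (conj oU Ux)) => y Uy; apply: IH => //.
exact: ltnW.
Qed.

Lemma Cn_coord {R : realType} {d m n : nat} (U : set 'rV[R]_d)
    (g : 'rV[R]_d -> 'rV[R]_m) (i : 'I_m) : open U -> Cn n U g ->
  Cn n U (fun x => g x ord0 i : R^o).
Proof.
move=> oU gC; have [cg dg] := gC.
have near_eq s x : (size s <= n)%N -> U x -> \forall y \near x,
    pderiv s g y ord0 i = pderiv s (fun x => g x ord0 i : R^o) y.
  move=> sn Ux; apply: filterS (open_nbhs_nbhs (conj oU Ux)) => y Uy.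
  by rewrite (pderiv_coord i oU gC).
split=> s sn x.
  move=> Ux; have /near_eq_cvg/cvg_trans := near_eq s x sn Ux; apply.
  rewrite (pderiv_coord i oU gC) //.
  exact: (continuous_comp (cg s sn x Ux) (@coord_continuous _ _ _ ord0 i _)).
move=> a Ux; apply: near_eq_derivable (near_eq s x (ltnW sn) Ux) _.
exact: (proj1 (derivable_mxP _ _ _) (dg s sn x a Ux)).
Qed.

(** There are finitely many partial derivatives of order at most [n], each
    continuous at [x]; a sum over them bounds them all. *)
Lemma pderiv_locally_bounded {R : realType} {d : nat} {W : normedModType R}
    (n : nat) (U : set 'rV[R]_d) (g : 'rV[R]_d -> W) (x : 'rV[R]_d) :
  Cn n U g -> U x ->
  exists2 B : R, 0 <= B & \forall y \near x,
    forall s, (size s <= n)%N -> `|pderiv s g y| <= B.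
Proof.
move=> [cg _] Ux.
have bnd s : (size s <= n)%N ->
    \forall y \near x, `|pderiv s g y| <= `|pderiv s g x| + 1.
  move=> sn; have /cvgrPdist_le/(_ 1 ltr01) := cg s sn x Ux.
  apply: filterS => y; rewrite distrC => yx.
  by rewrite -lerBlDl (le_trans (lerB_dist _ _)).
pose B l := \sum_(t : l.-tuple 'I_d) (`|pderiv t g x| + 1).
have B0 l : 0 <= B l by apply: sumr_ge0 => t _; rewrite addr_ge0.
have BP l (t : l.-tuple 'I_d) : `|pderiv t g x| + 1 <= B l.
  rewrite /B (bigD1 t) //= lerDl; apply: sumr_ge0 => t' _; exact: addr_ge0.
exists (\sum_(l < n.+1) B l); first by apply: sumr_ge0.
have : \forall y \near x, forall l : 'I_n.+1, forall t : l.-tuple 'I_d,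
    `|pderiv t g y| <= `|pderiv t g x| + 1.
  apply: (@filter_forall _ 'I_n.+1 (fun l y => forall t : l.-tuple 'I_d,
    `|pderiv t g y| <= `|pderiv t g x| + 1) (nbhs x) _ _) => l.
  apply: (@filter_forall _ _ (fun (t : l.-tuple 'I_d) y =>
    `|pderiv t g y| <= `|pderiv t g x| + 1) (nbhs x) _ _) => t; apply: bnd.
  by rewrite size_tuple -ltnS.
apply: filterS => y yB s sn.
have := yB (Ordinal (sn : (size s < n.+1)%N)) (in_tuple s).
move=> /= /le_trans; apply.
apply: le_trans (BP _ (in_tuple s)) _.
rewrite (bigD1 (Ordinal (sn : (size s < n.+1)%N))) //= lerDl.
by apply: sumr_ge0.
Qed.

Lemma jet_on_coord {R : realType} {d : nat} (k : nat) (S : set 'rV[R]_d)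
    (z : 'rV[R]_d) i : jet_on k S z 1 (fun x => (x - z) ord0 i).
Proof.
apply: (@jet_on_single _ _ _ _ _ _ 1) => //.
  move=> _.
  rewrite (_ : (fun x => _) = fun x : 'rV[R]_d => x ord0 i + - z ord0 i).
    by apply: polyfunD; [exact: polyfun_coord|exact: polyfun_cst].
  by apply/funext => x; rewrite !mxE.
by move=> x _; rewrite mul1r expr1 rV_coord_le.
Qed.

Lemma Cn_lipschitz {R : realType} {m n : nat} (f : 'rV[R]_m -> R^o)
    (V : set 'rV[R]_m) (c : 'rV[R]_m) (r B : R) :
  open V -> Cn n.+1 V f -> ball c r `<=` V ->
  (forall s y, (size s <= n.+1)%N -> ball c r y -> `|pderiv s f y| <= B) ->
  forall x z, ball c r x -> ball c r z -> `|f x - f z| <= B * m%:R * `|x - z|.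
Proof.
move=> oV fV cV fB x z cx cz.
have := taylor_remainder oV fV cV fB cz (v := x - z) _
  (j := 1) (s := [::]) (t := 1).
rewrite subrK => /(_ cx isT); rewrite ler01 lexx => /(_ isT).
rewrite scale1r subrK horner_poly big_ord1 /= invr1 mul1r expr0 mulr1 expr1.
by rewrite mulrA.
Qed.

(** The coordinates of [g] are composites with the identity map, whose own
    coordinates are jets for trivial reasons, so [jet_on_comp] produces their
    Taylor expansions. The constants serve every base point [z] near [x0]. *)
Lemma smooth_jets {R : realType} {d m : nat} (k : nat) (U : set 'rV[R]_d)
    (g : 'rV[R]_d -> 'rV[R]_m) (x0 : 'rV[R]_d) :
  open U -> Cn k.+1 U g -> U x0 ->
  exists C r : R, [/\ 0 <= C, 0 < r & forall S z, ball x0 r z ->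
    S `<=` ball x0 r -> (forall x, S x -> `|x - z| <= 1) ->
    (forall x, S x -> `|g x - g z| <= C * `|x - z|) /\
    (forall i, jet_on k S z C (fun x => (g x - g z) ord0 i))].
Proof.
move=> oU gC Ux0.
have [B B0 gB] := pderiv_locally_bounded gC Ux0.
have /nbhs_ballP[r /= r0 rP] : \forall x \near x0, U x /\
    (forall s, (size s <= k.+1)%N -> `|pderiv s g x| <= B).
  by apply: filterI => //; exact: open_nbhs_nbhs.
have [K K0 KP] := @jet_on_comp R d d k 1 ler01.
have rU : ball x0 r `<=` U by move=> x /rP[].
have giB i s y : (size s <= k.+1)%N -> ball x0 r y ->
    `|pderiv s (fun x => g x ord0 i : R^o) y| <= B.
  move=> sk /rP[Uy gy]; rewrite (pderiv_coord i oU gC) //.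
  by rewrite (le_trans (rV_coord_le _ _)) // gy.
have C0 : 0 <= B * d%:R by rewrite mulr_ge0.
exists (B * d%:R + (K * B + B)), r; split => //.
  by rewrite !addr_ge0 // mulr_ge0.
move=> S z zr Sr S1; split.
  move=> x Sx; apply: rV_norm_le.
    by rewrite !mulr_ge0 // !addr_ge0 // mulr_ge0.
  move=> i; rewrite !mxE.
  have giL := Cn_lipschitz oU (Cn_coord i oU gC) rU (giB i).
  apply: le_trans (giL x z (Sr x Sx) zr) _.
  by rewrite ler_wpM2r // lerDl addr_ge0 // mulr_ge0.
move=> i; apply: (@jet_on_le _ _ _ _ _ (K * B + B)); first by rewrite lerDr.
apply: (@eq_jet_on _ _ k S z _ (fun x => g x ord0 i + - g z ord0 i)).
  by move=> x _; rewrite !mxE.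
apply: jet_onD; last first.
  by apply: jet_on_cst; rewrite normrN; apply: (giB i [::]).
apply: (KP (fun x => g x ord0 i : R^o) U x0 r B id) => //.
- exact: Cn_coord.
- exact: giB.
- by move=> x _; rewrite mul1r.
- exact: jet_on_coord.
Qed.

(** * Polynomial approximation on the manifold *)

Section ManifoldApproximation.
Context {R : realType} {d m q : nat} (k : nat) (M : set 'rV[R]_d)
  (A : 'I_q -> chart R d m).
Hypothesis atlasA : atlas M A.

Definition chart_bound (F : 'rV[R]_d -> R) (B : R) : Prop :=
  forall (i : 'I_q) (s : seq 'I_m) y, (size s <= k.+1)%N ->
    chart_core (A i) y ->
    `|pderiv s (F \o chart_map (A i) : 'rV[R]_m -> R^o) y| <= B.

Lemma chart_bound_le F B : chart_bound F B -> forall x, M x -> `|F x| <= B.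
Proof.
move=> FB x Mx; have [_ /(_ x Mx) [i _ [y /interior_subset iy <-]]] := atlasA.
exact: (FB i [::] y).
Qed.

(** On [M] near [z0], [F] equals [(F \o chart_map (A i)) \o g] for the smooth
    ambient left inverse [g] of a parametrization of the atlas whose core
    contains [z0] in its interior. The derivatives of the outer factor are
    bounded by [B] on the core, and [g] does not depend on [F]. *)
Lemma manifold_jet (z0 : 'rV[R]_d) : M z0 ->
  exists C r : R, [/\ 0 <= C, 0 < r & forall z F B, ball z0 r z ->
    Cn_mfd m k.+1 M F -> chart_bound F B ->
    jet_on k (M `&` ball z r) z (C * B) F].
Proof.
move=> Mz0; have [Aloc /(_ z0 Mz0)] := atlasA.
move=> [i _ [y0 Ky0 y0z0]].
have [lp _ KV] := Aloc i.
have [oV _ [U [g [oU gC VU gK]]]] := lp.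
have VyU y : chart_dom (A i) y -> U (chart_map (A i) y).
  move=> Vy.
  have : (chart_map (A i) @` chart_dom (A i)) (chart_map (A i) y) by exists y.
  by rewrite VU => -[].
have Vy0 : chart_dom (A i) y0 := KV _ (interior_subset Ky0).
have Uz0 : U z0 by rewrite -y0z0; exact: VyU.
have gz0 : g z0 = y0 by rewrite -y0z0 gK.
have /nbhs_ballP[r0 /= r00 r0K] := Ky0.
have [C1 [r1 [C10 r10 gJ]]] := smooth_jets oU (gC k.+1) Uz0.
have cg : {for z0, continuous g}.
  by have [+ _] := gC 0%N; move=> /(_ [::] isT _ Uz0).
have /nbhs_ballP[r2 /= r20 r2P] : \forall x \near z0, U x /\ ball y0 r0 (g x).
  apply: filterI; first exact: open_nbhs_nbhs.
  by apply: cg; rewrite gz0; exact: nbhsx_ballx.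
have [K K0 KP] := @jet_on_comp R d m k C1 C10.
(* Halving lets a ball of radius [r] about a point of [ball z0 r] fit in the
   balls of radius [r1] and [r2] about [z0]. *)
pose r := Num.min 1 (Num.min (r1 / 2) (r2 / 2)).
have r_gt0 : 0 < r by rewrite !lt_min ltr01 !divr_gt0.
have [rle1 rler1 rler2] : [/\ r <= 1, r <= r1 / 2 & r <= r2 / 2].
  by split; rewrite /r !ge_min lexx ?orbT.
exists K, r; split => // z F B z0z FC FB.
have Sball x : (M `&` ball z r) x -> ball z0 (r + r) x.
  by move=> [_ zx]; apply: ball_triangle z0z zx.
have Sr1 : M `&` ball z r `<=` ball z0 r1.
  move=> x /Sball; apply: le_ball; lra.
have Sr2 : M `&` ball z r `<=` ball z0 r2.
  move=> x /Sball; apply: le_ball; lra.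
have z_r1 : ball z0 r1 z by move: z0z; apply: le_ball; lra.
have z_r2 : ball z0 r2 z by move: z0z; apply: le_ball; lra.
have S1 x : (M `&` ball z r) x -> `|x - z| <= 1.
  by move=> [_]; rewrite -ball_normE /= distrC => /ltW/le_trans; apply.
have [gL gjet] := gJ _ _ z_r1 Sr1 S1.
apply: (@eq_jet_on _ _ k _ z _ ((F \o chart_map (A i)) \o g)).
  move=> x Sx; have [Mx _] := Sx; have [Ux _] := r2P _ (Sr2 x Sx).
  have : (M `&` U) x by [].
  by rewrite -VU => -[y Vy yx] /=; rewrite -yx gK.
apply: (KP _ (chart_dom (A i)) y0 r0) => //.
- exact: FC.
- by move=> y /r0K /KV.
- by move=> s y sk /r0K iy; apply: FB.
- by have [] := r2P _ z_r2.
- by move=> x /Sr2 /r2P[].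
Qed.

Definition poly_approx (L : R) (z : 'rV[R]_d) : Prop :=
  forall F B, Cn_mfd m k.+1 M F -> chart_bound F B ->
  forall rho : R, 0 < rho -> exists2 p, poly_le k p &
    forall x, M x -> `|x - z| < rho ->
      `|F x - poly_eval p x| <= L * B * rho ^+ k.+1.

(** Below the radius [r] of [manifold_jet] the polynomial is the sum of the
    polynomial terms of the jet. Above it, the constant [F z] suffices, because
    [`|F x - F z| <= 2 * B <= 2 * B * (rho / r) ^+ k.+1]. *)
Lemma poly_approx_near (z0 : 'rV[R]_d) : M z0 ->
  exists2 L : R, 0 < L & \forall z \near z0, forall L', L <= L' ->
     M z -> poly_approx L' z.
Proof.
move=> Mz0; have [C [r [C0 r0 CP]]] := manifold_jet Mz0.
have r'0 : 0 < 2 / r ^+ k.+1 by rewrite divr_gt0 // exprn_gt0.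
exists (C + 2 / r ^+ k.+1); first by rewrite ltr_wpDl.
near=> z => L' LL' Mz F B FC FB rho rho0.
have B0 : 0 <= B by apply: le_trans (chart_bound_le FB Mz).
have rhok : 0 <= rho ^+ k.+1 by rewrite exprn_ge0 // ltW.
have L'0 : C <= L' by apply: le_trans LL'; rewrite lerDl ltW.
have [rho_r|r_rho] := leP rho r.
  have /CP/(_ FC FB)[P [P1 P2 P3]] : ball z0 r z by near: z; exact: nbhsx_ballx.
  have [|p pk pP] := @polyfun_sum R d k _ (index_enum 'I_k.+1) xpredT P.
    move=> [i ik] _; apply: polyfun_le (P1 i _) => //; exact: (ik : (i <= k)%N).
  exists p => // x Mx xz.
  have Sx : (M `&` ball z r) x.
    by split=> //; rewrite -ball_normE /= distrC; apply: lt_le_trans rho_r.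
  rewrite -pP P3 // big_ord_recr /= addrAC subrr add0r.
  rewrite (le_trans (P2 _ _ _ Sx)) // ler_pM ?mulr_ge0 ?exprn_ge0 //.
    by rewrite ler_wpM2r.
  by rewrite lerXn2r ?nnegrE // ltW.
have [p pk pP] := @polyfun_cst R d k (F z).
exists p => // x Mx _; rewrite -pP.
apply: (@le_trans _ _ (2 * B)).
  rewrite (le_trans (ler_normB _ _)) // mulr_natl mulr2n lerD //.
    exact: chart_bound_le FB _ Mx.
  exact: chart_bound_le FB _ Mz.
rewrite mulrAC ler_wpM2r //.
apply: (@le_trans _ _ (2 / r ^+ k.+1 * rho ^+ k.+1)).
  rewrite -mulrA ler_peMr // mulrC ler_pdivlMr ?exprn_gt0 // mul1r.
  by rewrite lerXn2r ?nnegrE // ltW // (lt_trans r0).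
by rewrite ler_wpM2r // (le_trans _ LL') // lerDr.
Unshelve. all: by end_near. Qed.

Lemma poly_approx_uniform : compact M ->
  exists2 L : R, 0 < L & forall z, M z -> poly_approx L z.
Proof.
move=> /compact_near_coveringP cM.
have MP : \forall L \near +oo, M `<=` [set z | M z -> poly_approx L z].
  apply: cM => z0 Mz0; have [L _ LP] := poly_approx_near Mz0.
  exists ([set z | forall L', L <= L' -> M z -> poly_approx L' z],
      [set L' | L <= L']).
    by split=> //=; apply: nbhs_pinfty_ge; rewrite num_real.
  by move=> [z L'] [/= zP LL']; exact: zP.
have : \forall L \near +oo_R, 0 < L by apply: nbhs_pinfty_gt; rewrite num_real.
move=> /(filterI MP) /filter_ex[L [LP L0]].
by exists L => // z Mz; exact: (LP z).
Qed.

End ManifoldApproximation.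

(** * Length of curves and distance *)

Lemma coord_le_enorm {R : realType} {d : nat} (v : 'rV[R]_d) i :
  `|v ord0 i| <= enorm v.
Proof.
rewrite /enorm -sqrtr_sqr; apply: ler_wsqrtr.
rewrite /dot (bigD1 i) //= expr2 lerDl; apply: sumr_ge0 => j _.
by rewrite -expr2 sqr_ge0.
Qed.

Lemma continuous_enorm {R : realType} {d : nat} (g : R -> 'rV[R]_d) :
  continuous g -> continuous (fun t => enorm (g t)).
Proof.
move=> cg t.
have cgi i : continuous (fun t => g t ord0 i : R).
  move=> s.
  exact: (continuous_comp (cg s) (@coord_continuous _ _ _ ord0 i _)).
suff cd : continuous (fun t => dot (g t) (g t)).
  exact: (continuous_comp (cd t) (@sqrt_continuous R _)).
apply: continuous_big => [|i _ s]; first exact: add_continuous.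
by apply: continuousM; exact: cgi.
Qed.

(** For each coordinate, the displacement is the integral of the derivative,
    which the Euclidean speed dominates; the sup norm needs no more. *)
Lemma curve_length_ge {R : realType} {d : nat} (g : R -> 'rV[R]_d) :
  smooth_curve g -> (`|g 1 - g 0|%:E <= curve_length g)%E.
Proof.
move=> sg.
have dg (t : R) : derivable g t 1 by exact: (sg 0%N t).
have cg' : continuous (derive1 g).
  move=> t; apply: differentiable_continuous.
  exact/derivable1_diffP/(sg 1%N t).
have ce := continuous_enorm cg'.
have L0 : (0 <= curve_length g)%E.
  by apply: integral_ge0 => t _; rewrite lee_fin sqrtr_ge0.
have LP i : (`|(g 1 - g 0) ord0 i|%:E <= curve_length g)%E.
  have dgi (t : R) : derivable (fun t => g t ord0 i : R) t 1.
    exact: (proj1 (derivable_mxP _ _ _) (dg t)).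
  have dgiE t : derive1 (fun t => g t ord0 i : R) t = derive1 g t ord0 i.
    by rewrite !derive1E (derive_mx (dg t)) mxE.
  have cgi t : {for t, continuous (fun t => g t ord0 i : R)}.
    by apply: differentiable_continuous; apply/derivable1_diffP.
  have cg'i : continuous (fun t => derive1 g t ord0 i : R).
    move=> t.
    exact: (continuous_comp (cg' t) (@coord_continuous _ _ _ ord0 i _)).
  have FTC :
      (\int[lebesgue_measure]_(t in `[0%R, 1%R]) (derive1 g t ord0 i)%:E =
      (g 1 ord0 i)%:E - (g 0 ord0 i)%:E)%E.
    apply: (@continuous_FTC2 R (fun t => derive1 g t ord0 i)
        (fun t => g t ord0 i)) => //.
    - exact: continuous_subspaceT.
    - split=> //.
      + exact: cvg_at_right_filter (cgi 0).
      + exact: cvg_at_left_filter (cgi 1).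
  have -> : (`|(g 1 - g 0) ord0 i|%:E = `|(g 1 ord0 i)%:E - (g 0 ord0 i)%:E|)%E.
    by rewrite !mxE.
  rewrite -FTC.
  apply: (le_trans (le_abse_integral _ _ _)) => //.
    apply/measurable_EFinP; apply: measurable_funTS.
    exact: continuous_measurable_fun.
  apply: ge0_le_integral => //.
  - apply/measurable_EFinP; apply: measurable_funTS.
    by apply: measurableT_comp => //; exact: continuous_measurable_fun.
  - apply/measurable_EFinP; apply: measurable_funTS.
    exact: continuous_measurable_fun.
  - by move=> t _; rewrite lee_fin coord_le_enorm.
case: (curve_length g) L0 LP => [l||] // L0 LP; last by rewrite leey.
rewrite lee_fin; apply: rV_norm_le; first by rewrite -lee_fin.
by move=> i; rewrite -lee_fin.
Qed.

Lemma rdist_ge {R : realType} {d : nat} (M : set 'rV[R]_d) (x y : 'rV[R]_d) :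
  (`|x - y|%:E <= rdist M x y)%E.
Proof.
apply: le_ereal_inf_tmp => _ [n [g [[sg gx gy gg] ->]]].
rewrite -gx -gy distrC.
elim: n {gy} sg gg => [|n IH] sg gg.
  by rewrite big_nat1; apply: curve_length_ge; have [] := sg 0%N isT.
rewrite big_nat_recr //=.
apply: (@le_trans _ _ ((`|g n 1 - g 0%N 0| + `|g n.+1 1 - g n.+1 0|)%:E)).
  by rewrite lee_fin -(gg n (leqnn _)) [leRHS]addrC -(subrKA (g n 1)) ler_normD.
rewrite EFinD leeD //.
  by apply: IH => i ik; [apply: sg|apply: gg]; rewrite ltnW.
by apply: curve_length_ge; have [] := sg n.+1 (leqnn _).
Qed.

(** * Minimizing the l1 norm *)

Section L1Minimization.
Context {R : realType} {d N q : nat} (b : 'I_q -> mpoly.mpoly d R)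
  (X : 'I_N -> 'rV[R]_d) (Xz : set 'rV[R]_d) (z : 'rV[R]_d).

Lemma supported_sum (a : 'I_N -> R) (g : 'I_N -> R) :
  (forall j, X j \notin Xz -> a j = 0) -> (forall j, a j = 0 -> g j = 0) ->
  \sum_(j < N | X j \in Xz) g j = \sum_j g j.
Proof.
move=> a0 g0; rewrite big_mkcond; apply: eq_bigr => j _.
by case: ifPn => // /a0/g0 ->.
Qed.

Lemma poly_eval_sum n (c : 'I_n -> R) (p : 'I_n -> mpoly.mpoly d R) x :
  poly_eval (\sum_i c i *: p i) x = \sum_i c i * poly_eval (p i) x.
Proof.
rewrite /poly_eval raddf_sum; apply: eq_bigr => i _; exact: mevalZ.
Qed.

Lemma feasible_reproduces k (a : 'I_N -> R) (p : mpoly.mpoly d R) :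
  poly_basis k b -> feasible b X Xz z a -> poly_le k p ->
  \sum_j a j * poly_eval p (X j) = poly_eval p z.
Proof.
move=> [_ bP] [a0 aP] /bP[c [-> _]].
under eq_bigr do rewrite poly_eval_sum mulr_sumr.
rewrite exchange_big poly_eval_sum; apply: eq_bigr => i _ /=.
rewrite -aP mulr_sumr (supported_sum (a := a)) // => [|j ->].
  by apply: eq_bigr => j _; rewrite mulrCA.
by rewrite mul0r mulr0.
Qed.

(** The sublevel set of the objective at the feasible point [a0] is compact: the
    coefficients off [Xz] are zero, so the objective controls all of them. *)
Lemma l1_minimizer_exists (a0 : 'I_N -> R) :
  feasible b X Xz z a0 -> exists a, l1_minimizer b X Xz z a.
Proof.
move=> fa0; pose L (v : 'rV[R]_N) : R := \sum_(j < N | X j \in Xz) `|v ord0 j|.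
have rowE (a : 'I_N -> R) : fun_of_matrix (\row_j a j) ord0 = a.
  by apply/funext => j; rewrite mxE.
have cc j : continuous (fun v : 'rV[R]_N => v ord0 j : R).
  by move=> v; exact: coord_continuous.
have cL : continuous L.
  apply: continuous_big => [|j _ v]; first exact: add_continuous.
  exact: (continuous_comp (cc j v) (@norm_continuous _ R _)).
pose K : set 'rV[R]_N := [set v : 'rV[R]_N |
  feasible b X Xz z (v ord0) /\ L v <= L (\row_j a0 j)].
have Ka0 : K (\row_j a0 j) by split=> //; rewrite rowE.
have cK : compact K.
  apply: bounded_closed_compact.
    exists (L (\row_j a0 j)); split; first exact: num_real.
    move=> B LB v [[v0 _] vL]; apply: rV_norm_le.
      by apply: le_trans (ltW LB); apply: sumr_ge0.
    move=> j; have [Xj|Xj] := boolP (X j \in Xz); last first.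
      rewrite v0 // normr0 (le_trans _ (ltW LB)) //.
      by apply: sumr_ge0.
    apply: le_trans (ltW LB); apply: le_trans vL.
    by rewrite /L (bigD1 j) //= lerDl; apply: sumr_ge0.
  have -> : K = \bigcap_(j in [set j | X j \notin Xz])
        ((fun v : 'rV[R]_N => v ord0 j) @^-1` [set 0]) `&`
      \bigcap_(i in setT) ((fun v : 'rV[R]_N => \sum_(j < N | X j \in Xz)
        v ord0 j * poly_eval (b i) (X j)) @^-1` [set poly_eval (b i) z]) `&`
      L @^-1` [set y | y <= L (\row_j a0 j)].
    apply/seteqP; split => v.
      by move=> [[v0 vb] vL]; split=> //; split=> // i _; exact: vb.
    by move=> [[v0 vb] vL]; split=> //; split=> // i; exact: vb.
  apply: closedI; last first.
    by apply: (continuous_closedP L).1 => //; exact: closed_le.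
  apply: closedI; apply: closed_bigI => j _.
    by apply: (continuous_closedP _).1 => //; exact: closed_eq.
  apply: (continuous_closedP _).1; last exact: closed_eq.
  apply: continuous_big => [|i _ v]; first exact: add_continuous.
  exact: (continuous_comp (cc i v) (@mulrr_continuous R _ _)).
have [|c /set_mem[cf cL0] cmin] := EVT_min_rV (ex_intro _ _ Ka0) cK (f := L).
  exact: continuous_subspaceT.
exists (c ord0); split => // a' fa'.
have La' : L (\row_j a' j) = \sum_(j < N | X j \in Xz) `|a' j|.
  by apply: eq_bigr => j _; rewrite mxE.
rewrite -La'; have [h|/ltW h] := leP (L (\row_j a' j)) (L (\row_j a0 j)).
  by apply: cmin; rewrite inE; split => //; rewrite rowE.
exact: le_trans cL0 h.
Qed.

End L1Minimization.

(** * Centers near every point *)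

Lemma rdist_ge0 {R : realType} {d : nat} (M : set 'rV[R]_d) (x y : 'rV[R]_d) :
  (0 <= rdist M x y)%E.
Proof. by apply: le_trans (rdist_ge M x y); rewrite lee_fin. Qed.

Lemma reproduction_has_center {R : realType} {d N m k : nat}
    (M Omega : set 'rV[R]_d) (Theta eps : R) (X : 'I_N -> 'rV[R]_d)
    (a : 'I_N -> 'rV[R]_d -> R) (z : 'rV[R]_d) :
  local_reproduction m k M Omega Theta eps X a -> Omega z ->
  exists j, rball M z (local_radius M Omega Theta eps X) (X j).
Proof.
move=> [_ /[apply] -[aP _ a0]]; apply: contrapT => /forallNP nj.
have [p pk p1] := @polyfun_cst R d k 1.
have := aP p pk; rewrite big1 => [|j _]; last by rewrite a0 ?mul0r.
by rewrite -p1 => /esym/eqP; rewrite oner_eq0.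
Qed.

Lemma reproduction_feasible {R : realType} {d N q m k : nat}
    (M Omega : set 'rV[R]_d) (Theta eps : R) (X : 'I_N -> 'rV[R]_d)
    (b : 'I_q -> mpoly.mpoly d R) (a : 'I_N -> 'rV[R]_d -> R) (z : 'rV[R]_d) :
  poly_basis k b ->
  local_reproduction m k M Omega Theta eps X a -> Omega z ->
  feasible b X (local_centers M Omega Theta eps X z) z (a^~ z).
Proof.
move=> [bk _] [_ /[apply] -[aP _ a0]].
have a0' j : X j \notin local_centers M Omega Theta eps X z -> a j z = 0.
  move=> /negP; rewrite inE => Xj; apply: a0 => Xj'; apply: Xj.
  by split => //; exists j.
split=> // i; rewrite (supported_sum a0') ?aP // => j ->; first exact: mul0r.
Qed.

(** The balls are open, so having a center in each of them forces their radius
    [rho = Theta * h / eps] to be positive, hence [h] too; and the distance to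
    the nearest center is less than [rho] everywhere, so [h <= rho]. Dividing by
    [h] bounds [eps]. *)
Lemma fill_dist_pos {R : realType} {d N : nat}
    (M Omega : set 'rV[R]_d) (Theta eps c : R) (X : 'I_N -> 'rV[R]_d) :
  Omega !=set0 -> 0 < eps -> (fill_dist M Omega X <= c%:E)%E ->
  (forall z, Omega z -> exists j,
     rball M z (local_radius M Omega Theta eps X) (X j)) ->
  0 < fine (fill_dist M Omega X) /\ eps <= Theta.
Proof.
move=> [x Ox] eps0 fc cov.
have f0 : (0 <= fill_dist M Omega X)%E.
  apply: le_ereal_sup_tmp; eexists; first by exists x.
  by apply: le_ereal_inf_tmp => _ [j _ <-]; exact: rdist_ge0.
have ffin : fill_dist M Omega X \is a fin_num.
  by rewrite ge0_fin_numE // (le_lt_trans fc) // ltry.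
have frho : fine (fill_dist M Omega X) <= local_radius M Omega Theta eps X.
  rewrite -lee_fin fineK //; apply: ge_ereal_sup => _ [y Oy <-].
  have [j [_ /ltW jy]] := cov y Oy; apply: le_trans jy.
  by apply: ereal_inf_lbound; exists j.
have rho0 : 0 < local_radius M Omega Theta eps X.
  have [j [_ jx]] := cov x Ox.
  by rewrite -lte_fin; apply: le_lt_trans jx; exact: rdist_ge0.
have h0 : 0 <= fine (fill_dist M Omega X) by apply: fine_ge0.
have h_gt0 : 0 < fine (fill_dist M Omega X).
  rewrite lt_neqAle h0 andbT; apply/eqP => h_eq0.
  by move: rho0; rewrite /local_radius -h_eq0 mulr0 mul0r ltxx.
split=> //; move: frho; rewrite /local_radius mulrAC.
by rewrite ler_pMl // ler_pdivlMr // mul1r.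
Qed.

(** * Stability and approximation *)

Lemma chart_bound_norm {R : realType} {d m r : nat} (k : nat)
    (A : 'I_r -> chart R d m) (F : 'rV[R]_d -> R) (B : R) :
  (Cn_mfd_norm A k.+1 F <= B%:E)%E -> chart_bound k A F B.
Proof.
move=> FB i s y sk iy; rewrite -lee_fin; apply: le_trans FB.
by apply: ereal_sup_ubound; exists i, s, y.
Qed.

Lemma Cn_mfd_norm_ge0 {R : realType} {d m r : nat} (k : nat)
    (M : set 'rV[R]_d) (A : 'I_r -> chart R d m) (F : 'rV[R]_d -> R) :
  atlas M A -> M !=set0 -> (0 <= Cn_mfd_norm A k F)%E.
Proof.
move=> [_ MA] [x /MA[i _ [y /interior_subset iy _]]].
by apply: le_ereal_sup_tmp; eexists; first by exists i, [::], y.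
Qed.

Lemma quasi_interpolation_error {R : realType} {N : nat} (eps e : R)
    (a g : 'I_N -> R) (g0 : R) : 0 <= e ->
  \sum_j `|a j| <= 1 + eps -> `|g0| <= e ->
  (forall j, a j != 0 -> `|g j| <= e) ->
  `|\sum_j a j * g j - g0| <= (2 + eps) * e.
Proof.
move=> e0 a1 g0e ge; rewrite (le_trans (ler_normB _ _)) //.
rewrite (_ : (2 + eps) * e = (1 + eps) * e + e); last by ring.
rewrite lerD // (le_trans (ler_norm_sum _ _ _)) //.
apply: (@le_trans _ _ (\sum_j `|a j| * e)); last first.
  by rewrite -mulr_suml ler_wpM2r.
apply: ler_sum => j _; rewrite normrM; have [->|aj0] := eqVneq (a j) 0.
  by rewrite normr0 !mul0r.
by rewrite ler_wpM2l // ge.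
Qed.

(* [a] ranges over all selections of l1-minimizers, as these need not be
   unique; [`|c|] is the max norm of the row vector [c]. *)
Theorem lemma3p1 (R : realType) (d m : nat) (M Omega : set 'rV[R]_d)
    (r : nat) (A : 'I_r -> chart R d m) :
  algebraic_manifold m M -> atlas M A ->
  Omega `<=` M -> compact Omega -> cone_condition M Omega ->
  forall (k : nat) (Theta : R) (eps0 : \bar R),
  reproduction_constant m k M Omega Theta eps0 ->
  exists Gamma CT : R, 0 < Gamma /\
  forall (eps : R) (N : nat) (X : 'I_N -> 'rV[R]_d)
         (q : nat) (b : 'I_q -> mpoly.mpoly d R),
  0 < eps -> (eps%:E < eps0)%E -> injective X -> (forall j, Omega (X j)) ->
  (fill_dist M Omega X <= (Gamma * eps)%:E)%E -> poly_basis k b ->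
  let Xloc := local_centers M Omega Theta eps X in
  (forall z, Omega z -> exists a, l1_minimizer b X (Xloc z) z a) /\
  forall a : 'I_N -> 'rV[R]_d -> R,
  (forall z, Omega z -> l1_minimizer b X (Xloc z) z (fun j => a j z)) ->
    (forall c : 'rV[R]_N,
       (sup_norm Omega (T_op a c) <= ((1 + eps) * `|c|)%:E)%E) /\
    (forall f : 'rV[R]_d -> R, Cn_on m k.+1 M Omega f ->
       (sup_norm Omega (fun z => T_op a (sampling X f) z - f z)%R <=
        (CT * (fine (fill_dist M Omega X) / eps) ^+ k.+1)%:E *
        Cn_on_norm M A Omega k.+1 f)%E).
Proof.
move=> [cM _ _] atl OM _ _ k Theta eps0 [G G0 repr].
have [L L0 LP] := @poly_approx_uniform _ _ _ _ k _ _ atl cM.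
(* Half of the constant of the hypothesis turns the non-strict bound on the fill
   distance into the strict one. *)
exists (G / 2), ((2 + Theta) * L * Theta ^+ k.+1); split; first exact: divr_gt0.
move=> eps N X q b eps_gt0 eps_lt Xinj XO fill_le bb Xloc.
have [a0 rep] : exists a, local_reproduction m k M Omega Theta eps X a.
  apply: repr => //; apply: le_lt_trans fill_le _.
  by rewrite lte_fin ltr_pM2r // ltr_pdivrMr // ltr_pMr // ltr1n.
have feas z (Oz : Omega z) := reproduction_feasible bb rep Oz.
split=> [z Oz|a amin]; first exact: l1_minimizer_exists (feas z Oz).
have a_l1 z : Omega z -> \sum_j `|a j z| <= 1 + eps.
  move=> Oz; have [[az0 _] az_min] := amin z Oz.
  rewrite -(supported_sum az0) => [|j ->]; last exact: normr0.
  apply: le_trans (az_min _ (feas z Oz)) _.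
  rewrite (supported_sum (proj1 (feas z Oz))) => [|j ->]; last exact: normr0.
  by have [_ /(_ z Oz)[]] := rep.
split=> [c|f [F0 [F0C F0f]]].
  apply: ge_ereal_sup => _ [z Oz <-]; rewrite lee_fin.
  rewrite (le_trans (ler_norm_sum _ _ _)) //.
  apply: (@le_trans _ _ (\sum_j `|a j z| * `|c|)).
    by apply: ler_sum => j _; rewrite normrM ler_wpM2l // rV_coord_le.
  by rewrite -mulr_suml ler_wpM2r // a_l1.
have [->|/set0P O0] := eqVneq Omega set0.
  by rewrite /sup_norm image_set0 ereal_sup0 leNye.
have [h0 epsT] := fill_dist_pos O0 eps_gt0 fill_le
  (fun z => reproduction_has_center rep (z := z)).
set h := fine _ in h0 *.
have T0 : 0 < Theta by apply: lt_le_trans epsT.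
set K := _ * (h / eps) ^+ _.
have K0 : 0 < K.
  by rewrite /K !mulr_gt0 ?exprn_gt0 ?divr_gt0 // addr_gt0.
rewrite -lee_pdivrMl //; apply: le_ereal_inf_tmp => _ [F [FC Ff] <-].
rewrite lee_pdivrMl //; apply: ge_ereal_sup => _ [z Oz <-].
have : (0 <= Cn_mfd_norm A k.+1 F)%E.
  by apply: Cn_mfd_norm_ge0 atl _; exists z; exact: OM.
case FB: (Cn_mfd_norm A k.+1 F) => [B| |] // B0; last first.
  by rewrite gt0_muley ?leey.
rewrite lee_fin in B0; have {}FB : chart_bound k A F B.
  by apply: chart_bound_norm; rewrite FB.
rewrite -EFinM lee_fin.
pose rho := local_radius M Omega Theta eps X.
have rhoE : rho = Theta * (h / eps) by rewrite /rho /local_radius mulrA.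
have rho0 : 0 < rho by rewrite rhoE mulr_gt0 // divr_gt0.
have [p pk pP] := LP z (OM z Oz) F B FC FB rho rho0.
have -> : T_op a (sampling X f) z - f z =
    \sum_j a j z * (F (X j) - poly_eval p (X j)) - (F z - poly_eval p z).
  under [in RHS]eq_bigr do rewrite mulrBr.
  rewrite sumrB (feasible_reproduces bb (proj1 (amin z Oz)) pk) opprB subrKA.
  rewrite Ff //; congr (_ - _); apply: eq_bigr => j _.
  by rewrite mxE Ff.
have e0 : 0 <= L * B * rho ^+ k.+1.
  by rewrite !mulr_ge0 // ?exprn_ge0 // ltW.
apply: le_trans (quasi_interpolation_error e0 (a_l1 z Oz) _ _) _.
- by apply: pP; [exact: OM|rewrite subrr normr0].
- move=> j aj0; apply: pP; first exact/OM/XO.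
  have /set_mem[_ [_ jz]] : X j \in Xloc z.
    by apply: contraNT aj0 => /(proj1 (proj1 (amin z Oz))) ->.
  rewrite distrC -lte_fin; apply: le_lt_trans jz; exact: rdist_ge.
rewrite /K rhoE exprMn.
rewrite [leRHS](_ : _ =
    (2 + Theta) * (L * B * (Theta ^+ k.+1 * (h / eps) ^+ k.+1))).
  by rewrite ler_wpM2r ?lerD2l // -exprMn -rhoE.
by ring.
Qed.
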